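(* Consider the linear system and the interval-based inference attack described in the context, in which all disturbance sets, initial sets and observation sets are intervals and in which every linear image/Minkowski sum is replaced by the tightest (smallest) interval containing it. Then all sets of the recursion are intervals and are computed as follows. For $k\ge1$: $$\mathcal{M}^x_{k-1|k}=\Psi(A_1^{-1})\mathcal{M}^x_{k|k}\oplus\Psi(-A_1^{-1}A_2)\mathcal{Y}_{k-1|k-1}\oplus\Psi(-A_1^{-1}B_1)\mathcal{W}^x_k,$$ $$\mathcal{M}^y_{k-1|k}=\Psi(A_2^{-1})\mathcal{M}^x_{k|k}\oplus\Psi(-A_2^{-1}A_1)\mathcal{X}_{k-1|k-1}\oplus\Psi(-A_2^{-1}B_1)\mathcal{W}^x_k,$$ $$\mathcal{X}_{k-1|k}=\begin{bmatrix}\max\{\underline{M}^x_{k-1|k},\underline{X}_{k-1|k-1}\}\\ \min\{\overline{M}^x_{k-1|k},\overline{X}_{k-1|k-1}\}\end{bmatrix},\qquad \mathcal{Y}_{k-1|k}=\begin{bmatrix}\max\{\underline{M}^y_{k-1|k},\underline{Y}_{k-1|k-1}\}\\ \min\{\overline{M}^y_{k-1|k},\overline{Y}_{k-1|k-1}\}\end{bmatrix},$$ $$\mathcal{M}^x_{k|k-1}=\Psi(A_1)\mathcal{X}_{k-1|k}\oplus\Psi(A_2)\mathcal{Y}_{k-1|k}\oplus\Psi(B_1)\mathcal{W}^x_k,\qquad \mathcal{X}_{k|k}=\begin{bmatrix}\max\{\underline{M}^x_{k|k},\underline{M}^x_{k|k-1}\}\\ \min\{\overline{M}^x_{k|k},\overline{M}^x_{k|k-1}\}\end{bmatrix},$$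 $$\mathcal{Y}_{k|k}=\Psi(A_3)\mathcal{X}_{k-1|k}\oplus\Psi(A_4)\mathcal{Y}_{k-1|k}\oplus\Psi(B_2)\mathcal{W}^y_k,$$ and the prior inference set of $Y_k$ is $$\mathcal{Y}_{k|k-1}=\Psi(A_3)\mathcal{X}_{k-1|k-1}\oplus\Psi(A_4)\mathcal{Y}_{k-1|k-1}\oplus\Psi(B_2)\mathcal{W}^y_k.$$ For $k=0$, $\mathcal{Y}_{0|0}=\mathcal{Y}_{0|-1}$ and $$\mathcal{X}_{0|0}=\begin{bmatrix}\max\{\underline{M}^x_{0|0},\underline{X}_{0|-1}\}\\ \min\{\overline{M}^x_{0|0},\overline{X}_{0|-1}\}\end{bmatrix}.$$ Here $$\Psi(A)=\begin{bmatrix}\frac{A+|A|}{2}&\frac{A-|A|}{2}\\ \frac{A-|A|}{2}&\frac{A+|A|}{2}\end{bmatrix}$$ with $|A|$ the entrywise absolute value.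
   Context: System: $X_k=A_1X_{k-1}+A_2Y_{k-1}+B_1W^x_k$, $Y_k=A_3X_{k-1}+A_4Y_{k-1}+B_2W^y_k$, with public state $X_k\in\mathbb{R}^{n_x}$, private state $Y_k\in\mathbb{R}^{n_x}$, real matrices of compatible sizes, $A_1,A_2$ invertible. Disturbances $W^x_k\in\mathcal{W}^x_k$, $W^y_k\in\mathcal{W}^y_k$, initial states $X_0\in\mathcal{X}_{0|-1}$, $Y_0\in\mathcal{Y}_{0|-1}$; all these sets are bounded intervals (boxes). At each $k$ the adversary receives an interval observation set $\mathcal{M}^x_{k|k}$ containing the true public state $x_k$ (so all intersections below are nonempty). Interval notation: an interval $\mathcal{Z}=\{Z:\underline{Z}\le Z\le\overline{Z}\}\subset\mathbb{R}^n$ (componentwise) is identified with its stacked endpoint vector $[\underline{Z}^\top,\overline{Z}^\top]^\top\in\mathbb{R}^{2n}$. In the formulas of the claim, a $2m\times2n$ matrix acts on an interval by multiplying its endpoint vector, $\oplus$ is the sum of endpoint vectors, and max/min are componentwise. The interval-based inference attack: at $k=0$ only prior knowledge is used for $Y_0$, so $\mathcal{Y}_{0|0}=\mathcal{Y}_{0|-1}$, and $\mathcal{X}_{0|0}=\mathcal{M}^x_{0|0}\cap\mathcal{X}_{0|-1}$. For $k\ge1$, writing $\square(\cdot)$ for the smallest interval containing a bounded set, $A\mathcal{Z}=\{AZ:Z\in\mathcal{Z}\}$ for images of sets and $+$ for Minkowski sums of sets: $\mathcal{M}^x_{k-1|k}=\square\big(A_1^{-1}\mathcal{M}^x_{k|k}+(-A_1^{-1}A_2)\mathcal{Y}_{k-1|k-1}+(-A_1^{-1}B_1)\mathcal{W}^x_k\big)$;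 $\mathcal{M}^y_{k-1|k}=\square\big(A_2^{-1}\mathcal{M}^x_{k|k}+(-A_2^{-1}A_1)\mathcal{X}_{k-1|k-1}+(-A_2^{-1}B_1)\mathcal{W}^x_k\big)$; $\mathcal{X}_{k-1|k}=\mathcal{M}^x_{k-1|k}\cap\mathcal{X}_{k-1|k-1}$; $\mathcal{Y}_{k-1|k}=\mathcal{M}^y_{k-1|k}\cap\mathcal{Y}_{k-1|k-1}$; $\mathcal{Y}_{k|k}=\square\big(A_3\mathcal{X}_{k-1|k}+A_4\mathcal{Y}_{k-1|k}+B_2\mathcal{W}^y_k\big)$; $\mathcal{M}^x_{k|k-1}=\square\big(A_1\mathcal{X}_{k-1|k}+A_2\mathcal{Y}_{k-1|k}+B_1\mathcal{W}^x_k\big)$; $\mathcal{X}_{k|k}=\mathcal{M}^x_{k|k}\cap\mathcal{M}^x_{k|k-1}$; and the prior inference set is $\mathcal{Y}_{k|k-1}=\square\big(A_3\mathcal{X}_{k-1|k-1}+A_4\mathcal{Y}_{k-1|k-1}+B_2\mathcal{W}^y_k\big)$. *)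

(* Defs.v *)
From mathcomp Require Import all_boot all_order all_algebra.
From mathcomp Require Import classical_sets reals.
Set Implicit Arguments.
Unset Strict Implicit.
Unset Printing Implicit Defensive.
Import Order.TTheory GRing.Theory Num.Theory.
Local Open Scope classical_set_scope.
Local Open Scope ring_scope.

Definition vle (R : realType) n (u v : 'cV[R]_n) : Prop :=
  forall i, u i 0 <= v i 0.

(* The interval with stacked endpoint vector z, i.e. with lower endpoint
   usubmx z and upper endpoint dsubmx z. *)
Definition box (R : realType) n (z : 'cV[R]_(n + n)) : set 'cV[R]_n :=
  [set v | vle (usubmx z) v /\ vle v (dsubmx z)].

(* Intervals are nonempty, so that each one has a unique endpoint vector. *)
Definition endpoints_of (R : realType) n (Z : set 'cV[R]_n) : set 'cV[R]_(n + n) :=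
  [set z | vle (usubmx z) (dsubmx z) /\ Z = box z].

Definition is_interval (R : realType) n (Z : set 'cV[R]_n) : Prop :=
  endpoints_of Z !=set0.

(* The endpoint vector of an interval; the default value 0 is only taken on
   sets that are not intervals. *)
Definition ends (R : realType) n (Z : set 'cV[R]_n) : 'cV[R]_(n + n) :=
  xget 0 (endpoints_of Z).

Definition hull (R : realType) n (Z : set 'cV[R]_n) : set 'cV[R]_n :=
  smallest (@is_interval R n) Z.

Definition mximage (R : realType) m n (A : 'M[R]_(m, n)) (Z : set 'cV[R]_n) :
    set 'cV[R]_m := [set A *m v | v in Z].

Definition msum (R : realType) n (Z T : set 'cV[R]_n) : set 'cV[R]_n :=
  [set u + v | u in Z & v in T].

Definition absmx (R : realType) m n (A : 'M[R]_(m, n)) : 'M[R]_(m, n) :=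
  map_mx (fun a => `|a|) A.

Definition Psi (R : realType) m n (A : 'M[R]_(m, n)) : 'M[R]_(m + m, n + n) :=
  block_mx (2^-1 *: (A + absmx A)) (2^-1 *: (A - absmx A))
           (2^-1 *: (A - absmx A)) (2^-1 *: (A + absmx A)).

Definition maxmin (R : realType) n (z t : 'cV[R]_(n + n)) : 'cV[R]_(n + n) :=
  col_mx (map2_mx Num.max (usubmx z) (usubmx t))
         (map2_mx Num.min (dsubmx z) (dsubmx t)).

Record linsys (R : realType) (n p q : nat) := LinSys {
  A1 : 'M[R]_n; A2 : 'M[R]_n; A3 : 'M[R]_n; A4 : 'M[R]_n;
  B1 : 'M[R]_(n, p); B2 : 'M[R]_(n, q) }.

(* The step from time k to time k.+1 is driven by the disturbances of index
   k.+1; the disturbances of index 0 are irrelevant. *)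
Definition trajectory (R : realType) n p q (L : linsys R n p q)
    (x y : nat -> 'cV[R]_n) (wx : nat -> 'cV[R]_p) (wy : nat -> 'cV[R]_q) : Prop :=
  forall k,
    x k.+1 = A1 L *m x k + A2 L *m y k + B1 L *m wx k.+1 /\
    y k.+1 = A3 L *m x k + A4 L *m y k + B2 L *m wy k.+1.

(* X0 and Y0 are the prior sets X_{0|-1} and Y_{0|-1}; Mx k is the observation
   set M^x_{k|k}. *)
Record knowledge (R : realType) (n p q : nat) := Knowledge {
  X0 : set 'cV[R]_n; Y0 : set 'cV[R]_n;
  Wx : nat -> set 'cV[R]_p; Wy : nat -> set 'cV[R]_q;
  Mx : nat -> set 'cV[R]_n }.

(* Operators of one step of the attack.  X and Y are the sets available for the
   states at time k; M, W, V are the observation set and the two disturbance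
   sets at time k.+1. *)
Section Step.
Context {R : realType} {n p q : nat}.
Implicit Types (L : linsys R n p q) (X Y M : set 'cV[R]_n).
Implicit Types (W : set 'cV[R]_p) (V : set 'cV[R]_q).

Definition x_backward L M Y W : set 'cV[R]_n :=
  hull (msum (msum (mximage (invmx (A1 L)) M)
                   (mximage (- (invmx (A1 L) *m A2 L)) Y))
             (mximage (- (invmx (A1 L) *m B1 L)) W)).

Definition y_backward L M X W : set 'cV[R]_n :=
  hull (msum (msum (mximage (invmx (A2 L)) M)
                   (mximage (- (invmx (A2 L) *m A1 L)) X))
             (mximage (- (invmx (A2 L) *m B1 L)) W)).

Definition x_forward L X Y W : set 'cV[R]_n :=
  hull (msum (msum (mximage (A1 L) X) (mximage (A2 L) Y)) (mximage (B1 L) W)).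

Definition y_forward L X Y V : set 'cV[R]_n :=
  hull (msum (msum (mximage (A3 L) X) (mximage (A4 L) Y)) (mximage (B2 L) V)).

Definition step L M W V (XY : set 'cV[R]_n * set 'cV[R]_n) :
    set 'cV[R]_n * set 'cV[R]_n :=
  let: (X, Y) := XY in
  let Xs := x_backward L M Y W `&` X in
  let Ys := y_backward L M X W `&` Y in
  (M `&` x_forward L Xs Ys W, y_forward L Xs Ys V).

End Step.

Section Attack.
Context {R : realType} {n p q : nat}.
Implicit Types (L : linsys R n p q) (K : knowledge R n p q) (k : nat).

(* (X_{k|k}, Y_{k|k}) *)
Fixpoint filt L K k : set 'cV[R]_n * set 'cV[R]_n :=
  if k is j.+1 then step L (Mx K j.+1) (Wx K j.+1) (Wy K j.+1) (filt L K j)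
  else (Mx K 0 `&` X0 K, Y0 K).

Definition Xfilt L K k := (filt L K k).1.

Definition Yfilt L K k := (filt L K k).2.

(* M^x_{k|k+1} *)
Definition Mxback L K k :=
  x_backward L (Mx K k.+1) (Yfilt L K k) (Wx K k.+1).

(* M^y_{k|k+1} *)
Definition Myback L K k :=
  y_backward L (Mx K k.+1) (Xfilt L K k) (Wx K k.+1).

(* X_{k|k+1} *)
Definition Xback L K k := Mxback L K k `&` Xfilt L K k.

(* Y_{k|k+1} *)
Definition Yback L K k := Myback L K k `&` Yfilt L K k.

(* M^x_{k+1|k} *)
Definition Mxpred L K k :=
  x_forward L (Xback L K k) (Yback L K k) (Wx K k.+1).

(* Y_{k+1|k} *)
Definition Ypred L K k :=
  y_forward L (Xfilt L K k) (Yfilt L K k) (Wy K k.+1).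

End Attack.

Lemma XfiltS (R : realType) n p q (L : linsys R n p q) (K : knowledge R n p q) k :
  Xfilt L K k.+1 = Mx K k.+1 `&` Mxpred L K k.
Proof.
by rewrite /Xfilt /Mxpred /Xback /Yback /Mxback /Myback /Xfilt /Yfilt /=; case: filt.
Qed.

Lemma YfiltS (R : realType) n p q (L : linsys R n p q) (K : knowledge R n p q) k :
  Yfilt L K k.+1 = y_forward L (Xback L K k) (Yback L K k) (Wy K k.+1).
Proof.
by rewrite /Yfilt /Xback /Yback /Mxback /Myback /Xfilt /Yfilt /=; case: filt.
Qed.

(* Main.v *)
(* The image of an interval under a linear map need not be an interval, but in
   each coordinate its extreme values are attained: row i of A is minimised at
   the vertex picking the lower endpoint where A i j >= 0 and the upper one where
   A i j < 0.  A set contained in an interval and touching all its faces has that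
   interval as its hull, and the touching property passes to Minkowski sums, with
   the endpoint vectors adding up.  Intersections are nonempty because they
   contain the true state; this drives the induction on time. *)
Require Import Defs.
From mathcomp Require Import all_boot all_order all_algebra.
From mathcomp Require Import classical_sets reals ring.
Set Implicit Arguments.
Unset Strict Implicit.
Unset Printing Implicit Defensive.
Import Order.TTheory GRing.Theory Num.Theory.
Local Open Scope classical_set_scope.
Local Open Scope ring_scope.

Section Intervals.
Context {R : realType}.

(** The witness may change with the coordinate [i]: a linear image of a box need not contain a
    single point attaining all the extremes at once. *)
Definition touches_faces n (Z : set 'cV[R]_n) (z : 'cV[R]_(n + n)) : Prop :=
  [/\ Z `<=` box z,
      forall i, exists2 v, Z v & v i 0 = usubmx z i 0
    & forall i, exists2 v, Z v & v i 0 = dsubmx z i 0].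

(** A nonempty box contains its own two extreme corners, so each of the two boxes contains the
    corners of the other. This makes [ends] well determined. *)
Lemma endpoints_of_inj n (Z : set 'cV[R]_n) z t :
  endpoints_of Z z -> endpoints_of Z t -> z = t.
Proof.
move=> [zle ->] [tle zt].
have [tl tu] : box t (usubmx z) /\ box t (dsubmx z).
  by rewrite -zt; split; split=> // i.
have [zl zu] : box z (usubmx t) /\ box z (dsubmx t).
  by rewrite zt; split; split=> // i.
rewrite -[z]vsubmxK -[t]vsubmxK; congr col_mx; apply/colP => i; apply/le_anti.
  by rewrite (zl.1 i) (tl.1 i).
by rewrite (zu.2 i) (tu.2 i).
Qed.

Lemma is_intervalP n (Z : set 'cV[R]_n) : is_interval Z -> endpoints_of Z (ends Z).
Proof. by move=> [z Zz]; exact: (xgetPex 0 (ex_intro _ z Zz)). Qed.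

Lemma endpoints_ends n (Z : set 'cV[R]_n) z : endpoints_of Z z -> ends Z = z.
Proof.
move=> Zz; apply: endpoints_of_inj (Zz).
by apply: is_intervalP; exists z.
Qed.

Lemma endpoints_interval n (Z : set 'cV[R]_n) z :
  endpoints_of Z z -> is_interval Z.
Proof. by move=> Zz; exists z. Qed.

Lemma sub_hull n (Z : set 'cV[R]_n) : Z `<=` hull Z.
Proof. by move=> v Zv T [_]; apply. Qed.

(** The set [box z] is a competitor in the intersection defining [hull Z], its endpoints being
    ordered because points of [Z] lie between them. Any other competitor contains the points of [Z]
    on the faces of [box z], so its bounds are no tighter. *)
Lemma hull_touches n (Z : set 'cV[R]_n) z :
  touches_faces Z z -> endpoints_of (hull Z) z.
Proof.
move=> [Zz Zl Zu]; split.
  by move=> i; have [v /Zz[zv _] <-] := Zu i; exact: zv.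
apply/seteqP; split=> v.
  apply; split=> //; exists z; split=> // i.
  by have [w /Zz[zw _] <-] := Zu i; exact: zw.
move=> [lv vu] _ [[t [_ ->]] Zt]; split=> i.
  by apply: le_trans (lv i); have [w /Zt[tw _] <-] := Zl i; exact: tw.
by apply: le_trans (vu i) _; have [w /Zt[_ wt] <-] := Zu i; exact: wt.
Qed.

Lemma msum_touches n (Z T : set 'cV[R]_n) z t :
  touches_faces Z z -> touches_faces T t -> touches_faces (msum Z T) (z + t).
Proof.
move=> [Zz Zlo Zup] [Tt Tlo Tup]; split.
- move=> _ [u /Zz[lu uu] [v /Tt[lv uv] <-]].
  by split=> i; rewrite linearD mxE [leRHS]mxE; apply: lerD.
- move=> i; have [[u Zu ui] [v Tv vi]] := (Zlo i, Tlo i).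
  by exists (u + v); [exists u => //; exists v|rewrite linearD mxE ui vi [RHS]mxE].
- move=> i; have [[u Zu ui] [v Tv vi]] := (Zup i, Tup i).
  by exists (u + v); [exists u => //; exists v|rewrite linearD mxE ui vi [RHS]mxE].
Qed.

(** The blocks of [Psi] hold positive and negative parts of entries. As conditionals on the same
    test, they merge into one choice of endpoint per entry. *)
Lemma half_addr_norm (a : R) : 2^-1 * (a + `|a|) = if 0 <= a then a else 0.
Proof. by case: ger0P => _; [field|rewrite subrr mulr0]. Qed.

Lemma half_subr_norm (a : R) : 2^-1 * (a - `|a|) = if 0 <= a then 0 else a.
Proof. by case: ger0P => _; [rewrite subrr mulr0|rewrite opprK; field]. Qed.

Lemma Psi_usub m n (A : 'M[R]_(m, n)) (z : 'cV[R]_(n + n)) i :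
  usubmx (Psi A *m z) i 0 =
  \sum_j A i j * (if 0 <= A i j then usubmx z j 0 else dsubmx z j 0).
Proof.
rewrite /Psi -{1}[z]vsubmxK mul_block_col col_mxKu 3!mxE -big_split /=.
apply: eq_bigr => j _; rewrite !mxE half_addr_norm half_subr_norm.
by case: ifP; rewrite mul0r ?addr0 ?add0r.
Qed.

Lemma Psi_dsub m n (A : 'M[R]_(m, n)) (z : 'cV[R]_(n + n)) i :
  dsubmx (Psi A *m z) i 0 =
  \sum_j A i j * (if 0 <= A i j then dsubmx z j 0 else usubmx z j 0).
Proof.
rewrite /Psi -{1}[z]vsubmxK mul_block_col col_mxKd 3!mxE -big_split /=.
apply: eq_bigr => j _; rewrite !mxE half_addr_norm half_subr_norm.
by case: ifP; rewrite mul0r ?addr0 ?add0r.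
Qed.

Lemma mximage_touches m n (A : 'M[R]_(m, n)) (Z : set 'cV[R]_n) z :
  endpoints_of Z z -> touches_faces (mximage A Z) (Psi A *m z).
Proof.
move=> [zle ->]; split.
(* The bounds hold term by term: a factor [A i j] that is nonnegative preserves the inequalities on
   [v j 0], a negative one reverses them. *)
- move=> _ [v [lv vu] <-]; split=> i; rewrite ?Psi_usub ?Psi_dsub mxE.
    apply: ler_sum => j _; case: ifPn => [a0|]; first exact: ler_wpM2l.
    by rewrite -ltNge => /ltW a0; exact: ler_wnM2l.
  apply: ler_sum => j _; case: ifPn => [a0|]; first exact: ler_wpM2l.
  by rewrite -ltNge => /ltW a0; exact: ler_wnM2l.
- move=> i; rewrite Psi_usub.
  (* This vertex minimises row [i] and depends on [i]; it lies in [box z] because the endpoints are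
     ordered. *)
  set v := \col_j (if 0 <= A i j then usubmx z j 0 else dsubmx z j 0).
  exists (A *m v); last by rewrite mxE; apply: eq_bigr => j _; rewrite [v _ _]mxE.
  by exists v => //; split=> j; rewrite [v _ _]mxE; case: ifP.
- move=> i; rewrite Psi_dsub.
  (* The opposite vertex maximises row [i]. *)
  set v := \col_j (if 0 <= A i j then dsubmx z j 0 else usubmx z j 0).
  exists (A *m v); last by rewrite mxE; apply: eq_bigr => j _; rewrite [v _ _]mxE.
  by exists v => //; split=> j; rewrite [v _ _]mxE; case: ifP.
Qed.

(** Both backward sets, both predictions and the update of the private state are hulls of this
    three-term shape. *)
Lemma hull_linear_combination n m1 m2 m3 (A : 'M[R]_(n, m1)) (B : 'M[R]_(n, m2))
    (C : 'M[R]_(n, m3)) Z T W :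
  is_interval Z -> is_interval T -> is_interval W ->
  endpoints_of (hull (msum (msum (mximage A Z) (mximage B T)) (mximage C W)))
    (Psi A *m ends Z + Psi B *m ends T + Psi C *m ends W).
Proof.
move=> /is_intervalP Zi /is_intervalP Ti /is_intervalP Wi.
by apply/hull_touches/msum_touches; [apply: msum_touches|]; exact: mximage_touches.
Qed.

Lemma mem_hull_linear_combination n m1 m2 m3 (A : 'M[R]_(n, m1))
    (B : 'M[R]_(n, m2)) (C : 'M[R]_(n, m3)) Z T W u v w :
  Z u -> T v -> W w ->
  hull (msum (msum (mximage A Z) (mximage B T)) (mximage C W))
    (A *m u + B *m v + C *m w).
Proof.
move=> Zu Tv Ww; apply: sub_hull.
exists (A *m u + B *m v); last by exists (C *m w) => //; exists w.
by exists (A *m u); [exists u|exists (B *m v) => //; exists v].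
Qed.

Lemma setI_endpoints n (Z T : set 'cV[R]_n) v :
  is_interval Z -> is_interval T -> Z v -> T v ->
  endpoints_of (Z `&` T) (maxmin (ends Z) (ends T)).
Proof.
move=> /is_intervalP[_ EZ] /is_intervalP[_ ET].
set z := ends Z in EZ *; set t := ends T in ET *.
have ZTE : Z `&` T = box (maxmin z t).
  rewrite EZ ET; apply/seteqP; split=> w; rewrite /box /vle /= col_mxKu col_mxKd.
    by move=> [[lz uz] [lt ut]]; split=> i; rewrite mxE ?ge_max ?le_min ?lz ?lt ?uz ?ut.
  move=> [l u]; split; split=> i.
  - by have := l i; rewrite mxE ge_max => /andP[].
  - by have := u i; rewrite mxE le_min => /andP[].
  - by have := l i; rewrite mxE ge_max => /andP[].
  - by have := u i; rewrite mxE le_min => /andP[].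
(* The common point [v] lies between the new endpoints and so keeps them from crossing. *)
move=> Zv Tv; split=> // i.
have [l u] : box (maxmin z t) v by rewrite -ZTE.
exact: le_trans (l i) (u i).
Qed.

End Intervals.

(** Solving the dynamics for the earlier state gives exactly the combination whose hull is the
    backward set, which therefore contains the true state. *)
Lemma solve_left_summand (R : realType) n p (A B : 'M[R]_n) (C : 'M[R]_(n, p))
    (x y z : 'cV[R]_n) (w : 'cV[R]_p) :
  A \in unitmx -> z = A *m x + B *m y + C *m w ->
  x = invmx A *m z + - (invmx A *m B) *m y + - (invmx A *m C) *m w.
Proof.
move=> Au ->; rewrite !mulmxDr mulKmx // !mulNmx -!mulmxA.
by rewrite addrAC !addrK.
Qed.

Theorem lemma6 (R : realType) (n p q : nat)
    (L : linsys R n p q) (K : knowledge R n p q)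
    (x y : nat -> 'cV[R]_n) (wx : nat -> 'cV[R]_p) (wy : nat -> 'cV[R]_q)
    (hA1 : A1 L \in unitmx) (hA2 : A2 L \in unitmx)
    (hX0 : is_interval (X0 K)) (hY0 : is_interval (Y0 K))
    (hWx : forall k, is_interval (Wx K k.+1))
    (hWy : forall k, is_interval (Wy K k.+1))
    (hMx : forall k, is_interval (Mx K k))
    (hxy : trajectory L x y wx wy)
    (hx0 : X0 K (x 0%N)) (hy0 : Y0 K (y 0%N))
    (hwx : forall k, Wx K k.+1 (wx k.+1))
    (hwy : forall k, Wy K k.+1 (wy k.+1))
    (hmx : forall k, Mx K k (x k)) :
  (forall k,
    [/\ is_interval (Xfilt L K k) /\ is_interval (Yfilt L K k),
        is_interval (Mxback L K k) /\ is_interval (Myback L K k),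
        is_interval (Xback L K k) /\ is_interval (Yback L K k)
      & is_interval (Mxpred L K k) /\ is_interval (Ypred L K k)]) /\
  (Yfilt L K 0 = Y0 K /\
   ends (Xfilt L K 0) = maxmin (ends (Mx K 0)) (ends (X0 K))) /\
  (forall k,
    ends (Mxback L K k) =
      Psi (invmx (A1 L)) *m ends (Mx K k.+1)
      + Psi (- (invmx (A1 L) *m A2 L)) *m ends (Yfilt L K k)
      + Psi (- (invmx (A1 L) *m B1 L)) *m ends (Wx K k.+1) /\
    ends (Myback L K k) =
      Psi (invmx (A2 L)) *m ends (Mx K k.+1)
      + Psi (- (invmx (A2 L) *m A1 L)) *m ends (Xfilt L K k)
      + Psi (- (invmx (A2 L) *m B1 L)) *m ends (Wx K k.+1) /\
    ends (Xback L K k) = maxmin (ends (Mxback L K k)) (ends (Xfilt L K k)) /\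
    ends (Yback L K k) = maxmin (ends (Myback L K k)) (ends (Yfilt L K k)) /\
    ends (Mxpred L K k) =
      Psi (A1 L) *m ends (Xback L K k)
      + Psi (A2 L) *m ends (Yback L K k)
      + Psi (B1 L) *m ends (Wx K k.+1) /\
    ends (Xfilt L K k.+1) = maxmin (ends (Mx K k.+1)) (ends (Mxpred L K k)) /\
    ends (Yfilt L K k.+1) =
      Psi (A3 L) *m ends (Xback L K k)
      + Psi (A4 L) *m ends (Yback L K k)
      + Psi (B2 L) *m ends (Wy K k.+1) /\
    ends (Ypred L K k) =
      Psi (A3 L) *m ends (Xfilt L K k)
      + Psi (A4 L) *m ends (Yfilt L K k)
      + Psi (B2 L) *m ends (Wy K k.+1)).
Proof.
(* The invariant includes membership of the true states, which supplies the common points for the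
   intersections. The facts below assume only [good k], so they serve both the induction and the
   final formulas. *)
pose good k := [/\ is_interval (Xfilt L K k), is_interval (Yfilt L K k),
  Xfilt L K k (x k) & Yfilt L K k (y k)].
have iMxback k : good k -> is_interval (Mxback L K k).
  by case=> *; apply/endpoints_interval/hull_linear_combination.
have iMyback k : good k -> is_interval (Myback L K k).
  by case=> *; apply/endpoints_interval/hull_linear_combination.
have Mxback_x k : good k -> Mxback L K k (x k).
  case=> _ _ _ Yy; have [xS _] := hxy k.
  rewrite (solve_left_summand hA1 xS).
  exact: mem_hull_linear_combination.
have Myback_y k : good k -> Myback L K k (y k).
  case=> _ _ Xx _; have [xS _] := hxy k.
  (* With the private state as leading summand, the same inversion applies to [A2 L]. *)
  rewrite [A1 L *m _ + _]addrC in xS.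
  rewrite (solve_left_summand hA2 xS).
  exact: mem_hull_linear_combination.
have iXback k : good k -> is_interval (Xback L K k).
  move=> gk; have [iX _ Xx _] := gk; apply: endpoints_interval.
  exact: setI_endpoints (iMxback k gk) iX (Mxback_x k gk) Xx.
have iYback k : good k -> is_interval (Yback L K k).
  move=> gk; have [_ iY _ Yy] := gk; apply: endpoints_interval.
  exact: setI_endpoints (iMyback k gk) iY (Myback_y k gk) Yy.
have iMxpred k : good k -> is_interval (Mxpred L K k).
  by move=> gk; apply/endpoints_interval/hull_linear_combination; auto.
have Xback_x k : good k -> Xback L K k (x k).
  by move=> gk; split; [exact: Mxback_x|case: gk].
have Yback_y k : good k -> Yback L K k (y k).
  by move=> gk; split; [exact: Myback_y|case: gk].
have Mxpred_x k : good k -> Mxpred L K k (x k.+1).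
  by move=> gk; have [-> _] := hxy k; apply: mem_hull_linear_combination; auto.
(* [eX0] and [eXS] are kept as endpoint statements: they yield the interval property in the
   induction and the [maxmin] formulas at the end. *)
have eX0 := setI_endpoints (hMx 0%N) hX0 (hmx 0%N) hx0.
have eXS k gk := setI_endpoints (hMx k.+1) (iMxpred k gk) (hmx k.+1) (Mxpred_x k gk).
have all_good k : good k.
  elim: k => [|k gk]; split=> //; rewrite ?XfiltS ?YfiltS.
  - exact: endpoints_interval eX0.
  - exact: endpoints_interval (eXS k gk).
  - by apply/endpoints_interval/hull_linear_combination; auto.
  - by split; [exact: hmx|exact: Mxpred_x].
  - by have [_ ->] := hxy k; apply: mem_hull_linear_combination; auto.
split=> [k|]; last split=> [|k].
- have [iX iY _ _] := all_good k; split; split; auto.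
  (* The remaining goal concerns [Ypred], a combination of the filtered sets themselves. *)
  by apply/endpoints_interval/hull_linear_combination.
- by split=> //; exact: endpoints_ends.
- have gk := all_good k; have [iX iY Xx Yy] := gk.
  have hullE := hull_linear_combination.
  rewrite XfiltS YfiltS; split; first by apply/endpoints_ends/hullE.
  split; first by apply/endpoints_ends/hullE.
  split.
    exact/endpoints_ends/(setI_endpoints (iMxback k gk) iX (Mxback_x k gk) Xx).
  split.
    exact/endpoints_ends/(setI_endpoints (iMyback k gk) iY (Myback_y k gk) Yy).
  split; first by apply/endpoints_ends/hullE; auto.
  split; first exact: endpoints_ends (eXS k gk).
  by split; apply/endpoints_ends/hullE; auto.
Qed.
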